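(* Let $A\subseteq {}^\bullet\mathbb{R}^n$ be an arbitrary subset and let $f,g:A\to{}^\bullet\mathbb{R}$ be (quasi-standard) smooth functions. If $f(x)=g(x)$ for all $x$ in a subset of $A$ that is dense in $A$ with respect to the $\omega$-topology, then $f(x)=g(x)$ for all $x\in A$.
   Context: Fermat reals: let $\mathbb{R}_o[t]$ be the set of maps $x:\mathbb{R}_{\ge0}\to\mathbb{R}$, $t\mapsto x_t$, of the form $x_t=r+\sum_{i=1}^k\alpha_i t^{a_i}+o(t)$ as $t\to0^+$, with $k\in\mathbb{N}$, $r,\alpha_i\in\mathbb{R}$, $a_i\in\mathbb{R}_{\ge0}$. Write $x\sim y$ iff $x_t=y_t+o(t)$ as $t\to0^+$. The ring of Fermat reals is ${}^\bullet\mathbb{R}:=\mathbb{R}_o[t]/\sim$ with pointwise operations; $\mathbb{R}\subseteq{}^\bullet\mathbb{R}$ via constant maps. For $a\in\mathbb{R}_{\ge1}$ let $\mathrm{d}t_a$ be the class of $t\mapsto t^{1/a}$. The standard part of $x=[x_t]$ is ${}^\circ x:=x_0$ (componentwise on ${}^\bullet\mathbb{R}^n$). Every $x\in{}^\bullet\mathbb{R}$ can be written uniquely as $x={}^\circ x+\sum_{i=1}^N\alpha_i\,\mathrm{d}t_{a_i}$ with $N\in\mathbb{N}$, $\alpha_i\in\mathbb{R}\setminus\{0\}$, $a_1>\dots>a_N\ge1$; the order of $x$ is $\omega(x):=a_1$ if $N\ge1$ and $\omega(x):=0$ if $N=0$. The $\omega$-topology on ${}^\bullet\mathbb{R}^n$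 is the topology induced by the metric $d_\omega(x,y):=\|{}^\circ x-{}^\circ y\|+\sum_{i=1}^n\omega(x_i-y_i)$; subsets carry the induced subspace topology. The Fermat topology on ${}^\bullet\mathbb{R}^n$ has as open sets the sets ${}^\bullet V:=\{x\in{}^\bullet\mathbb{R}^n:{}^\circ x\in V\}$ for $V\subseteq\mathbb{R}^n$ open. For $\alpha\in C^\infty(W,\mathbb{R}^m)$ with $W\subseteq\mathbb{R}^d$ open, its extension ${}^\bullet\alpha:{}^\bullet W\to{}^\bullet\mathbb{R}^m$ is ${}^\bullet\alpha([x_t]):=[\alpha(x_t)]$. A map $f:S\to{}^\bullet\mathbb{R}^m$ with $S\subseteq{}^\bullet\mathbb{R}^n$ is (quasi-standard) smooth if for every $x\in S$ there exist an open $V\subseteq\mathbb{R}^n$ with $x\in{}^\bullet V$, an open $P\subseteq\mathbb{R}^{\mathsf p}$, a parameter $p\in{}^\bullet P$ and $\alpha\in C^\infty(P\times V,\mathbb{R}^m)$ such that $f(y)={}^\bullet\alpha(p,y)$ for all $y\in{}^\bullet V\cap S$. *)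

(* Defs.v *)
From HB Require Import structures.
From mathcomp Require Import all_boot all_order all_algebra.
From mathcomp Require Import all_classical all_reals all_analysis.
From mathcomp Require Import Rstruct Rstruct_topology.
Set Implicit Arguments. Unset Strict Implicit. Unset Printing Implicit Defensive.
Import Order.TTheory GRing.Theory Num.Theory.
Import numFieldNormedType.Exports.
Local Open Scope classical_set_scope.
Local Open Scope ring_scope.

Section Fermat.
Variable R : realType.

(* Representatives: maps t |-> x_t (only t >= 0 is relevant). *)
Definition FR := R -> R.
Definition FRn (n : nat) := 'I_n -> FR.

Definition little_o_t (h : R -> R) : Prop :=
  h 0 = 0 /\ (fun t => h t / t) @ at_right 0 --> (0 : R).

Definition fequiv (x y : FR) : Prop := little_o_t (fun t => x t - y t).

Definition fequivn n (x y : FRn n) : Prop := forall i, fequiv (x i) (y i).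

Definition in_Rot (x : FR) : Prop :=
  exists (r : R) (s : seq (R * R)),
    all (fun p => 0 <= p.2) s /\
    little_o_t (fun t => x t - (r + \sum_(p <- s) p.1 * t `^ p.2)).

Definition in_Rotn n (x : FRn n) : Prop := forall i, in_Rot (x i).

Definition stdpart (x : FR) : R := x 0.
Definition stdpartn n (x : FRn n) : 'rV[R]_n := \row_i (x i 0).

(* decomposition x = °x + sum_i alpha_i dt_{a_i}, a_1 > ... > a_N >= 1,
   alpha_i <> 0, where dt_a is the class of t |-> t^(1/a). *)
Definition is_decomp (x : FR) (s : seq (R * R)) : Prop :=
  sorted (fun p q => q.2 < p.2) s /\
  all (fun p => (1 <= p.2) && (p.1 != 0)) s /\
  fequiv x (fun t => stdpart x + \sum_(p <- s) p.1 * t `^ (p.2)^-1).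

Definition omega (x : FR) : R :=
  xget 0 [set w | exists s, is_decomp x s /\ w = (head (0, 0) s).2 ].

Definition fsub (x y : FR) : FR := fun t => x t - y t.

Definition d_omega n (x y : FRn n) : R :=
  Num.sqrt (\sum_i (stdpart (x i) - stdpart (y i)) ^+ 2)
  + \sum_i omega (fsub (x i) (y i)).

Definition omega_dense_in n (D A : set (FRn n)) : Prop :=
  forall x, A x -> forall e : R, 0 < e -> exists y, D y /\ d_omega x y < e.

Fixpoint iterD {k : nat} (vs : seq 'rV[R]_k) (f : 'rV[R]_k -> R)
  : 'rV[R]_k -> R :=
  match vs with
  | [::] => f
  | v :: vs' => fun z => 'D_v (iterD vs' f) z
  end.

Definition smooth_on {k : nat} (W : set 'rV[R]_k) (f : 'rV[R]_k -> R) :=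
  forall (vs : seq 'rV[R]_k) z, W z -> differentiable (iterD vs f) z.

Definition ext_set n (V : set 'rV[R]_n) : set (FRn n) :=
  fun x => in_Rotn x /\ V (stdpartn x).

Definition ext_fun p n (alpha : 'rV[R]_(p + n) -> R) (q : FRn p) (y : FRn n)
  : FR := fun t => alpha (row_mx (\row_i q i t) (\row_j y j t)).

Definition qs_smooth n (S : set (FRn n)) (f : FRn n -> FR) : Prop :=
  forall x, S x ->
  exists (V : set 'rV[R]_n) (p : nat) (P : set 'rV[R]_p)
         (q : FRn p) (alpha : 'rV[R]_(p + n) -> R),
    open V /\ V (stdpartn x) /\ open P /\ ext_set P q /\
    smooth_on [set z | P (lsubmx z) /\ V (rsubmx z)] alpha /\
    (forall y, ext_set V y -> S y -> fequiv (f y) (ext_fun alpha q y)).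

(* A ⊆ •R^n, represented by a ~-saturated set of representatives;
   f : A -> •R a well-defined map on classes. *)
Definition fsubset n (A : set (FRn n)) : Prop :=
  (forall x, A x -> in_Rotn x) /\
  (forall x y, A x -> fequivn x y -> A y).

Definition fmap_on n (A : set (FRn n)) (f : FRn n -> FR) : Prop :=
  (forall x, A x -> in_Rot (f x)) /\
  (forall x y, A x -> fequivn x y -> fequiv (f x) (f y)).

End Fermat.

(* Main.v *)
(* A point of D at omega-distance < 1 from x differs from x by a real vector r,
   since nonzero infinitesimals have order >= 1; density thus yields points
   x + r of A, with r arbitrarily small, at which f and g agree.  Taylor
   expansion at the standard part gives
     f (x + r) = sum_j c_j(r) m_j + o(t),
   with c_j continuous in r and monomials m_j in the infinitesimal parts of x
   and of the parameter that do not depend on r, and likewise for g.  The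
   coefficient vectors whose combination is o(t) form a linear subspace of a
   finite-dimensional space, which is closed, so we can let r tend to 0. *)
Require Import Defs.
From HB Require Import structures.
From mathcomp Require Import all_boot all_order all_algebra.
From mathcomp Require Import all_classical all_reals all_analysis.
From mathcomp Require Import Rstruct Rstruct_topology.
Local Open Scope classical_set_scope.

Section FermatIdentity.
Set Implicit Arguments. Unset Strict Implicit. Unset Printing Implicit Defensive.
Import Order.TTheory GRing.Theory Num.Theory.
Import numFieldNormedType.Exports.
Local Open Scope ring_scope.

Variable R : realType.

(** * Linear structure of o(t) functions and the resulting equivalence *)

Lemma little_o0 : little_o_t (0 : R -> R).
Proof.
split=> //; rewrite (_ : (fun t => _) = cst 0); first exact: cvg_cst.
by apply/funext => t /=; rewrite mul0r.
Qed.

Lemma little_oP (a : R) (u v : R -> R) :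
  little_o_t u -> little_o_t v -> little_o_t (a *: u + v).
Proof.
move=> [u0 ul] [v0 vl]; split.
  by rewrite -[LHS]/(a * u 0 + v 0) u0 v0 mulr0 addr0.
rewrite (_ : (fun t => _) = (fun t => a * (u t / t) + v t / t)); last first.
  by apply/funext => t; rewrite mulrA -mulrDl.
rewrite -[X in _ --> X](addr0 (0 : R)) -[X in _ --> X + _](mulr0 a).
by apply: cvgD => //; apply: cvgM => //; exact: cvg_cst.
Qed.

Lemma little_oD (u v : R -> R) :
  little_o_t u -> little_o_t v -> little_o_t (u + v).
Proof. by move=> ou ov; rewrite -[u]scale1r; exact: little_oP. Qed.

Lemma little_oZ (a : R) (u : R -> R) : little_o_t u -> little_o_t (a *: u).
Proof.
by move=> ou; rewrite -[_ *: _]addr0; apply: little_oP => //; exact: little_o0.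
Qed.

Lemma little_oN (u : R -> R) : little_o_t u -> little_o_t (- u).
Proof. by rewrite -scaleN1r; exact: little_oZ. Qed.

Lemma little_oB (u v : R -> R) :
  little_o_t u -> little_o_t v -> little_o_t (u - v).
Proof. by move=> ou /little_oN; exact: little_oD. Qed.

Lemma little_o_sum (I : Type) (r : seq I) (P : pred I) (F : I -> R -> R) :
  (forall i, P i -> little_o_t (F i)) -> little_o_t (\sum_(i <- r | P i) F i).
Proof. by move=> oF; elim/big_ind: _ => //; [exact: little_o0|exact: little_oD]. Qed.

Lemma little_o_le (u v : R -> R) : little_o_t v -> u 0 = 0 ->
  (\forall t \near 0^'+, `|u t| <= `|v t|) -> little_o_t u.
Proof.
move=> [v0 vl] u0 uv; split => //.
apply/norm_cvg0P; apply: (@squeeze_cvgr _ _ _ _ (cst 0) (fun t => `|v t / t|)).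
- near=> t; rewrite normr_ge0 /= !normrM ler_wpM2r //.
  by near: t.
- exact: cvg_cst.
- exact/norm_cvg0P.
Unshelve. all: by end_near. Qed.

Lemma powR_little_o (a : R) : 1 < a -> little_o_t (fun t : R => t `^ a).
Proof.
move=> a1; split; first by rewrite powR0 // gt_eqF // (lt_trans _ a1).
apply: (@cvg_trans _ ((t `^ (a - 1)) @[t --> 0^'+])); last first.
  have a0 : 0 < a - 1 by rewrite subr_gt0.
  exact: (powR_cvg0 a0).
apply: near_eq_cvg; near=> t.
have t0 : 0 < t by near: t; exact: nbhs_right_gt.
rewrite powRD; last by apply/implyP => _; rewrite gt_eqF.
by rewrite powRN powRr1 // ltW.
Unshelve. all: by end_near. Qed.

Lemma fequiv_refl (x : FR R) : fequiv x x.
Proof.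
rewrite /fequiv (_ : (fun t => _) = 0); first exact: little_o0.
by apply/funext => t; rewrite subrr.
Qed.

Lemma fequiv_sym (x y : FR R) : fequiv x y -> fequiv y x.
Proof.
move=> /little_oN; rewrite /fequiv; congr little_o_t.
by apply/funext => t; rewrite -[LHS]/(- (x t - y t)) opprB.
Qed.

Lemma fequiv_trans (x y z : FR R) : fequiv x y -> fequiv y z -> fequiv x z.
Proof.
move=> xy yz; move: (little_oD xy yz); rewrite /fequiv; congr little_o_t.
by apply/funext => t; rewrite -[LHS]/((x t - y t) + (y t - z t)) addrA subrK.
Qed.

(* Induct on the number of vectors: either [m j] lies in the span of the others
   modulo [L] and is eliminated, or [c j r] vanishes for all relevant [r]. *)
Lemma subspace_lim (V : lmodType R) (L : V -> Prop) (T : Type)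
  (F : set_system T) (PF : ProperFilter F) (J : Type) (s : seq J) (m : J -> V)
  (c : J -> T -> R) (c0 : J -> R) :
  L 0 -> (forall a u v, L u -> L v -> L (a *: u + v)) ->
  (forall j, c j @ F --> c0 j) ->
  (forall A : set T, F A -> exists2 r, A r & L (\sum_(j <- s) c j r *: m j)) ->
  L (\sum_(j <- s) c0 j *: m j).
Proof.
move=> L0 LP; elim: s c c0 => [|j s IH] c c0 cc frL; first by rewrite big_nil.
(* If [m j] is congruent modulo [L] to a combination of the others, substituting it turns the
   coefficients into [c i + c j * l i], which still converge. *)
have [[l Ll]|nl] := pselect (exists l : J -> R,
    L (m j - \sum_(i <- s) l i *: m i)).
  have e (a : J -> R) : \sum_(i <- j :: s) a i *: m i =
      a j *: (m j - \sum_(i <- s) l i *: m i)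
      + \sum_(i <- s) (a i + a j * l i) *: m i.
    rewrite big_cons scalerBr -addrA; congr (_ + _).
    rewrite scaler_sumr addrC -sumrB; apply: eq_bigr => i _.
    by rewrite scalerDl scalerA addrK.
  rewrite e; apply: (LP) => //.
  apply: (IH (fun i r => c i r + c j r * l i)) => [i|A FA].
    by apply: cvgD => //; apply: cvgM => //; exact: cvg_cst.
  have [r Ar Lr] := frL _ FA; exists r => //.
  have := LP (- c j r) _ _ Ll Lr.
  by rewrite (e (c ^~ r)) scaleNr addKr.
(* If [c j r] were nonzero, dividing the relation by it would express [m j] through the other
   vectors modulo [L]. *)
have cj0 r : L (\sum_(i <- j :: s) c i r *: m i) -> c j r = 0.
  apply: contraPP => /eqP cj Lr; apply: nl.
  exists (fun i => - ((c j r)^-1 * c i r)).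
  have := LP (c j r)^-1 _ _ Lr L0; rewrite addr0 big_cons scalerDr scalerA.
  rewrite mulVf // scale1r; congr (L (_ + _)).
  rewrite -sumrN scaler_sumr; apply: eq_bigr => i _.
  by rewrite scaleNr opprK scalerA.
have c0j : c0 j = 0.
  (* A nonzero limit would keep [c j] away from 0 on a whole set of [F], but that set contains a
     point where [c j] vanishes. *)
  apply/eqP/negPn/negP => c0j.
  have /cvgrPdist_lt/(_ `|c0 j|) := cc j.
  rewrite normr_gt0 => /(_ c0j) nr.
  have [r /= + /cj0 cr] := frL _ nr.
  by rewrite cr subr0 ltxx.
rewrite big_cons c0j scale0r add0r.
apply: (IH c) => // A FA; have [r Ar Lr] := frL _ FA; exists r => //.
by move: (Lr); rewrite big_cons (cj0 r Lr) scale0r add0r.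
Qed.

(** * Taylor expansion in several variables *)

Lemma is_derive_sumZ (V : normedModType R) (I : Type) (r : seq I) (a : I -> R)
  (G : I -> V -> R) (dG : I -> R) z v :
  (forall i, is_derive z v (G i) (dG i)) ->
  is_derive z v (fun z => \sum_(i <- r) a i * G i z) (\sum_(i <- r) a i * dG i).
Proof.
move=> dG_; elim: r => [|i r IH].
  rewrite big_nil (_ : (fun _ => _) = cst 0); first exact: is_derive_cst.
  by apply/funext => y; rewrite big_nil.
rewrite big_cons (_ : (fun _ => _) =
    (a i *: G i) + (fun z => \sum_(i <- r) a i * G i z)).
  by apply: is_deriveD => //; exact: is_deriveZ.
by apply/funext => y; rewrite big_cons.
Qed.

(** Differentiating the remainder of order [N.+1] gives the remainder of order [N] of the shifted
    sequence. It vanishes at 0, so the mean value theorem on [0, s] with s at most 1 carries the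
    bound [M] over unchanged. *)
Lemma taylor_bound (N : nat) (phi : nat -> R -> R) (M : R) :
  (forall n (s : R), 0 <= s <= 1 -> is_derive s 1 (phi n) (phi n.+1 s)) ->
  (forall s : R, 0 <= s <= 1 -> `|phi N s| <= M) ->
  forall s : R, 0 <= s <= 1 ->
    `|phi 0%N s - \sum_(n < N) (n`!%:R)^-1 * phi n 0 * s ^+ n| <= M.
Proof.
elim: N phi => [|N IH] phi dphi bphi s s01; first by rewrite big_ord0 subr0 bphi.
pose T (N : nat) (phi : nat -> R -> R) s :=
  phi 0%N s - \sum_(n < N) (n`!%:R)^-1 * phi n 0 * s ^+ n.
rewrite -/(T N.+1 phi s).
pose psi n := phi n.+1.
have dT (x : R) : 0 <= x <= 1 -> is_derive x 1 (T N.+1 phi) (T N psi x).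
  move=> x01; rewrite (_ : T N.+1 phi = phi 0%N - (cst (phi 0%N 0) +
    (fun x : R => \sum_(n <- index_enum 'I_N)
        ((n.+1)`!%:R)^-1 * phi n.+1 0 * x ^+ n.+1))).
    apply: is_deriveB; first exact: dphi.
    rewrite -[X in is_derive _ _ _ X]add0r; apply: is_deriveD.
    rewrite (_ : \sum_(n < N) _ = \sum_(n <- index_enum 'I_N)
       ((n.+1)`!%:R)^-1 * phi n.+1 0 * (n.+1%:R * x ^+ n)).
      apply: is_derive_sumZ => n.
      rewrite (_ : (fun x : R => _) = (id : R -> R) ^+ n.+1); last first.
        by apply/funext => y; rewrite exprfctE.
            apply: is_derive_eq (is_deriveX n.+1 (is_derive_id x (1 : R))) _.
      by rewrite /= /GRing.scale /= mulr1.
    apply: eq_bigr => n _; rewrite factS natrM invfM /psi.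
    rewrite [(n.+1%:R)^-1 * _]mulrC -!mulrA; congr (_ * _).
    by rewrite [RHS]mulrCA mulKf // pnatr_eq0.
  apply/funext => y; rewrite /T big_ord_recl /= fact0 expr0 mulr1 invr1 mul1r.
  by [].
have [s0 s1] := andP s01.
have [||c c0s] := @MVT_segment R (T N.+1 phi) (T N psi) 0 s s0.
- move=> x; rewrite in_itv /= => /andP[x0 xs].
  by apply: dT; rewrite ltW //= (le_trans (ltW xs)).
- apply: derivable_within_continuous => x; rewrite in_itv /= => /andP[x0 xs].
  by apply: ex_derive; apply: dT; rewrite x0 (le_trans xs).
have T0 : T N.+1 phi 0 = 0.
  rewrite /T big_ord_recl fact0 invr1 mul1r expr0 mulr1 big1 ?addr0 ?subrr //.
  by move=> i _; rewrite expr0n mulr0.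
rewrite T0 !subr0 => ->; move: c0s; rewrite in_itv /= => /andP[c0 cs].
rewrite normrM (ger0_norm s0) -[leRHS]mulr1; apply: ler_pM => //.
have c01 : 0 <= c <= 1 by rewrite c0 (le_trans cs s1).
exact: (IH psi (fun n => dphi n.+1) bphi c c01).
Qed.

Lemma derive_rVE k (f : 'rV[R]_k -> R) z v : differentiable f z ->
  'D_v f z = \sum_i v 0 i * 'D_(delta_mx 0 i) f z.
Proof.
move=> df; rewrite deriveE // [in LHS](row_sum_delta v) linear_sum.
by apply: eq_bigr => i _; rewrite linearZ /= deriveE.
Qed.

(** Words stand in for multi-indices: a multi-index occurs once for each of its orderings, which
    accounts for the multinomial coefficients. *)
Definition words (k m : nat) : seq (seq 'I_k) :=
  iter m (fun ws => [seq i :: w | i <- index_enum 'I_k, w <- ws]) [:: [::]].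

Definition monomial k (v : 'rV[R]_k) (w : seq 'I_k) : R := \prod_(i <- w) v 0 i.

Definition partialD k (f : 'rV[R]_k -> R) (w : seq 'I_k) : 'rV[R]_k -> R :=
  Defs.iterD [seq delta_mx 0 i | i <- w] f.

(** The derivative along [v] is the combination of the partial derivatives with weights [v 0 i];
    each further derivative therefore prefixes one letter to every word. *)
Lemma iterD_nseq k (W : set 'rV[R]_k) (f : 'rV[R]_k -> R) m v z :
  open W -> smooth_on W f -> W z ->
  Defs.iterD (nseq m v) f z = \sum_(w <- words k m) monomial v w * partialD f w z.
Proof.
move=> oW fW; elim: m z => [|m IH] z Wz.
  by rewrite /words /= big_seq1 /monomial big_nil mul1r.
rewrite [LHS]/=.
have -> : 'D_v (Defs.iterD (nseq m v) f) z = 'D_v (fun z =>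
    \sum_(w <- words k m) monomial v w * partialD f w z) z.
  (* The induction hypothesis holds only on [W]; as [W] is open, it holds near [z], which suffices
     for a derivative at [z]. *)
  apply: near_eq_derive; near=> y; apply: IH; near: y.
  exact: open_nbhs_nbhs.
have dpf w : differentiable (partialD f w) z by exact: fW.
rewrite (@derive_val _ _ _ _ _ _ _ (is_derive_sumZ (words k m) (monomial v)
  (fun w => derivableP (diff_derivable (dpf w))))).
rewrite /words iterS -/(words k m) big_allpairs_dep exchange_big /=.
apply: eq_bigr => w _; rewrite derive_rVE // mulr_sumr; apply: eq_bigr => i _.
by rewrite /monomial big_cons mulrCA mulrA.
Unshelve. all: by end_near. Qed.

Lemma cvg_sum_seq (T : Type) (F : set_system T) (FF : Filter F) (I : Type)
  (r : seq I) (f : I -> T -> R) (l : I -> R) :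
  (forall i, f i @ F --> l i) ->
  (fun x => \sum_(i <- r) f i x) @ F --> \sum_(i <- r) l i.
Proof.
move=> fl; elim: r => [|i r IH].
  rewrite big_nil (_ : (fun x => _) = cst 0); first exact: cvg_cst.
  by apply/funext => x; rewrite big_nil.
rewrite big_cons (_ : (fun x => _) = f i \+ (fun x => \sum_(i <- r) f i x)).
  exact: cvgD.
by apply/funext => x; rewrite big_cons.
Qed.

Lemma is_derive_line (V : normedModType R) (g : V -> R) z d (s : R) :
  derivable g (z + s *: d) d ->
  is_derive s 1 (fun s : R => g (z + s *: d)) ('D_d g (z + s *: d)).
Proof.
have e : (fun h : R => h^-1 *: (g (z + (h *: (1 : R) + s) *: d) - g (z + s *: d)))
       = (fun h : R => h^-1 *: (g (h *: d + (z + s *: d)) - g (z + s *: d))).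
  apply/funext => h; do 3 f_equal.
  by rewrite -[h *: (1 : R)]/(h * 1) mulr1 scalerDl addrCA.
by move=> dg; split; rewrite /derivable /derive /= e.
Qed.

Lemma ler_mx_entry k (d : 'rV[R]_k) i : `|d 0 i| <= `|d|.
Proof.
by rewrite [leRHS]/Num.norm /= mx_normrE; apply/bigmax_geP; right; exists (0, i).
Qed.

Lemma size_words k m w : w \in words k m -> size w = m.
Proof.
elim: m w => [|m IH] w; first by rewrite inE => /eqP ->.
by move=> /allpairsP[[i v] /= [_ vw ->]] /=; rewrite (IH v).
Qed.

Lemma ler_monomial k (d : 'rV[R]_k) w : `|monomial d w| <= `|d| ^+ size w.
Proof.
rewrite /monomial; elim: w => [|i w IH]; first by rewrite big_nil normr1.
by rewrite big_cons normrM exprS ler_pM // ler_mx_entry.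
Qed.

Definition taylor k (f : 'rV[R]_k -> R) (z : 'rV[R]_k) N (d : 'rV[R]_k) : R :=
  \sum_(n < N) \sum_(w <- words k n) (n`!%:R)^-1 * monomial d w * partialD f w z.

(** Restricting [f] to the segment from [z] to [z + d] reduces this to one variable at s = 1. The
    derivative of order [N] along the segment is a sum of monomials of degree [N] in [d], whence the
    factor [|d| ^+ N]. *)
Lemma taylor_smooth k (W : set 'rV[R]_k) (f : 'rV[R]_k -> R) z N :
  open W -> smooth_on W f -> W z ->
  exists C, \forall d \near (0 : 'rV[R]_k),
    `|f (z + d) - taylor f z N d| <= C * `|d| ^+ N.
Proof.
move=> oW fW Wz.
pose B y := \sum_(w <- words k N) `|partialD f w y|.
have FF : Filter (nbhs z) := nbhs_filter z.
have cB : B y @[y --> z] --> B z.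
  apply: (cvg_sum_seq FF) => w; apply: cvg_norm.
  exact: (differentiable_continuous (fW _ _ Wz)).
(* By continuity the partial derivatives of order [N] are bounded near [z] by a constant independent
   of [d]; adding 1 leaves room for the strict inequality. *)
have : \forall y \near z, W y /\ B y < B z + 1.
  apply: filterI; first exact: open_nbhs_nbhs.
  by apply: (@cvgr_lt R _ _ FF B (B z) cB); rewrite ltrDl.
move=> /nbhs_ballP[e /= e0 eW].
exists (B z + 1); apply/nbhs_ballP; exists e => //= d.
rewrite -ball_normE /= sub0r normrN => de.
have zW s : 0 <= s <= 1 -> W (z + s *: d) /\ B (z + s *: d) < B z + 1.
  move=> /andP[s0 s1]; apply: eW.
  rewrite -ball_normE /= opprD addrA subrr sub0r normrN.
  rewrite normrZ (ger0_norm s0); apply: le_lt_trans de.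
  by rewrite -[leRHS]mul1r ler_wpM2r.
pose phi n s := Defs.iterD (nseq n d) f (z + s *: d).
have phiE n s : 0 <= s <= 1 -> phi n s =
    \sum_(w <- words k n) monomial d w * partialD f w (z + s *: d).
  by move=> /zW[Ws _]; rewrite /phi (iterD_nseq _ _ oW).
have dphi n (s : R) : 0 <= s <= 1 -> is_derive s 1 (phi n) (phi n.+1 s).
  move=> /zW[Ws _]; apply: is_derive_line.
  by apply: diff_derivable; exact: fW.
have bphi s : 0 <= s <= 1 -> `|phi N s| <= (B z + 1) * `|d| ^+ N.
  move=> s01; have [_ /ltW Bs] := zW _ s01.
  rewrite phiE // (le_trans (ler_norm_sum _ _ _)) //.
  apply: (le_trans _ (ler_wpM2r _ Bs)); last exact: exprn_ge0.
  rewrite /B mulr_suml big_seq [leRHS]big_seq; apply: ler_sum => w ww.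
  rewrite normrM mulrC ler_wpM2l //.
  by rewrite -(size_words ww) ler_monomial.
have := taylor_bound dphi bphi (s := 1).
rewrite ler01 lexx => /(_ isT).
rewrite {1}/phi scale1r /=; congr (`|_ - _| <= _).
apply: eq_bigr => n _; rewrite expr1n mulr1 phiE ?lexx ?ler01 //.
by rewrite scale0r addr0 mulr_sumr; apply: eq_bigr => w _; rewrite mulrA.
Qed.

(** * Nilpotency of infinitesimal parts *)

Lemma little_o_cvg0 (h : R -> R) : little_o_t h -> h t @[t --> 0^'+] --> 0.
Proof.
move=> [_ hl]; apply: (@cvg_trans _ ((h t / t * t) @[t --> 0^'+])).
  apply: near_eq_cvg; near=> t.
  have t0 : 0 < t by [].
  by rewrite divfK // gt_eqF.
have t0 : t @[t --> 0^'+] --> (0 : R) by exact/cvg_at_right_filter/cvg_id.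
have := cvgM hl t0; rewrite mulr0; exact.
Unshelve. all: by end_near. Qed.

Lemma little_o_norm (h : R -> R) : little_o_t h -> little_o_t (fun t => `|h t|).
Proof.
move=> oh; apply: (little_o_le oh); first by case: (oh) => ->; rewrite normr0.
by apply: nearW => t; rewrite normr_id.
Qed.

(** This encodes nilpotency modulo o(t). Asking it of all large powers lets the bounds of several
    functions be merged by a maximum; since [little_o_t] prescribes the value 0 at 0, it also forces
    [h 0 = 0]. *)
Definition finite_order (h : R -> R) : Prop :=
  exists K, forall k, (K <= k)%N -> little_o_t (fun t => h t ^+ k).

Lemma finite_order_little_o (h : R -> R) : little_o_t h -> finite_order h.
Proof.
move=> oh; exists 1%N => -[//|k] _; apply: (little_o_le oh).
  by case: (oh) => -> _; rewrite expr0n.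
have h1 := cvgr_norm_le _ (little_o_cvg0 oh) 1.
rewrite normr0 in h1; near=> t.
rewrite exprS normrM -[leRHS]mulr1 ler_wpM2l // normrX exprn_ile1 //.
by near: t; exact: h1.
Unshelve. all: by end_near. Qed.

(** With a and b the absolute values of u and v, the k-th power of a + b is at most that of 2 max(a,
    b), hence at most 2^k (a^k + b^k). *)
Lemma finite_orderD (u v : R -> R) :
  finite_order u -> finite_order v -> finite_order (u + v).
Proof.
move=> [K oK] [L oL]; exists (maxn K L) => k; rewrite geq_max => /andP[Kk Lk].
have [u0 _] := oK k Kk; have [v0 _] := oL k Lk.
apply: (@little_o_le _
    (2 ^+ k *: ((fun t => `|u t ^+ k|) + (fun t => `|v t ^+ k|)))).
- by apply/little_oZ/little_oD; apply: little_o_norm; [exact: oK|exact: oL].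
- have k0 : (0 < k)%N.
    by case: k {Kk Lk v0} u0 => // /eqP; rewrite expr0 oner_eq0.
  move/eqP: u0; move/eqP: v0; rewrite !expf_eq0 k0 /= => /eqP v0 /eqP u0.
  by rewrite -[(u + v) 0]/(u 0 + v 0) u0 v0 addr0 expr0n eqn0Ngt k0.
apply: nearW => t; rewrite normrX.
rewrite -[leRHS]/(`|2 ^+ k * (`|u t ^+ k| + `|v t ^+ k|)|).
rewrite [leRHS]ger0_norm ?mulr_ge0 ?addr_ge0 ?exprn_ge0 //.
set a := `|u t|; set b := `|v t|.
apply: (@le_trans _ _ ((2 * Num.max a b) ^+ k)).
  rewrite lerXn2r ?nnegrE ?mulr_ge0 ?le_max ?normr_ge0 //.
  rewrite (le_trans (ler_normD _ _)) // mulr_natl mulr2n.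
  by rewrite lerD // le_max lexx ?orbT.
rewrite exprMn ler_wpM2l ?exprn_ge0 // !normrX -/a -/b.
by case: (leP a b) => _; rewrite ?lerDl ?lerDr exprn_ge0 // normr_ge0.
Qed.

Lemma finite_orderZ a (u : R -> R) : finite_order u -> finite_order (a *: u).
Proof.
move=> [K oK]; exists K => k Kk.
rewrite (_ : (fun t => _) = a ^+ k *: (fun t => u t ^+ k)).
  exact/little_oZ/oK.
by apply/funext => t; rewrite -[LHS]/((a * u t) ^+ k) exprMn.
Qed.

Lemma finite_order_powR (a : R) : 0 < a -> finite_order (fun t => t `^ a).
Proof.
(* Any k above 1/a makes the exponent a k exceed 1. *)
move=> a0; exists (Num.bound a^-1) => k Kk.
rewrite (_ : (fun t => _) = (fun t => t `^ (a * k%:R))).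
  apply: powR_little_o; rewrite -ltr_pdivrMl // mulr1.
  apply: (@lt_le_trans _ _ (Num.bound a^-1)%:R); last by rewrite ler_nat.
  by rewrite archi_boundP // invr_ge0 ltW.
by apply/funext => t; rewrite powRrM powR_mulrn // powR_ge0.
Qed.

Lemma in_Rot_finite_order (x : FR R) :
  in_Rot x -> finite_order (fun t => x t - x 0).
Proof.
move=> [r [s [s0 ho]]].
have [/eqP h0 _] := ho.
(* Each power is taken minus its value at 0, because a zero exponent contributes to the standard
   part: 0 to the power 0 is 1. *)
rewrite (_ : (fun t => _) = (fun t => x t - (r + \sum_(p <- s) p.1 * t `^ p.2))
    + \sum_(p <- s) p.1 *: (fun t => t `^ p.2 - 0 `^ p.2)).
  apply: finite_orderD; first exact: finite_order_little_o.
  elim: s s0 {ho h0} => [_|p s IH /= /andP[p0 s0]].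
    by rewrite big_nil; exact/finite_order_little_o/little_o0.
  rewrite big_cons; apply: finite_orderD; last exact: IH.
  apply: finite_orderZ; move: p0; rewrite le_eqVlt => /predU1P[<-|p0].
    apply: finite_order_little_o; rewrite (_ : (fun t => _) = 0).
      exact: little_o0.
    by apply/funext => t; rewrite !powRr0 subrr.
  rewrite (_ : (fun t => _) = (fun t => t `^ p.2)).
    exact: finite_order_powR.
  by apply/funext => t; rewrite powR0 ?gt_eqF // subr0.
apply/funext => t; rewrite -[RHS]/(_ + _) fct_sumE.
move: h0; rewrite subr_eq0 => /eqP ->.
have -> : \sum_(p <- s) (p.1 *: (fun t : R => t `^ p.2 - 0 `^ p.2)) t =
    \sum_(p <- s) p.1 * t `^ p.2 - \sum_(p <- s) p.1 * 0 `^ p.2.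
  by rewrite -sumrB; apply: eq_bigr => p _; rewrite -mulrBr.
by rewrite !opprD !addrA subrK.
Qed.

(** * Expansion of an extended smooth function along real translates *)

Definition fshift n (x : FRn R n) (r : 'rV[R]_n) : FRn R n :=
  fun i t => x i t + r 0 i.

Lemma stdpartn_fshift n (x : FRn R n) r :
  stdpartn (fshift x r) = stdpartn x + r.
Proof. by apply/rowP => i; rewrite !mxE. Qed.

(** One exponent serves all entries by taking a maximum, and the sup norm is attained at some entry,
    so its [N]-th power is at most the sum of those of the entries. *)
Lemma row_norm_little_o k (d : R -> 'rV[R]_k) :
  (forall i, finite_order (fun t => d t 0 i)) ->
  exists2 N, (0 < N)%N & little_o_t (fun t => `|d t| ^+ N).
Proof.
move=> fd; have [K HK] := choice fd.
pose N := (\max_i K i).+1; exists N => //.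
have oN i : little_o_t (fun t => d t 0 i ^+ N).
  by apply: HK; rewrite (leq_trans (leq_bigmax i)).
apply: (@little_o_le _ (\sum_i (fun t => `|d t 0 i ^+ N|))).
- by apply: little_o_sum => i _; apply: little_o_norm.
- suff -> : d 0 = 0 by rewrite normr0 expr0n.
  apply/rowP => i; rewrite mxE; have [/eqP + _] := oN i.
  by rewrite expf_eq0 => /eqP.
apply: nearW => t; rewrite fct_sumE normrX normr_id.
rewrite [leRHS]ger0_norm ?sumr_ge0 //.
have [d0|d0] := eqVneq (mx_norm (d t)) 0.
  by rewrite [`|d t|]d0 expr0n sumr_ge0.
have [[i j] /= dj] := mx_norm_neq0 d0.
rewrite [`|d t|]dj (ord1 i) (bigD1 j) //= normrX lerDl.
by apply: sumr_ge0.
Qed.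

(** Since [|d t| ^+ N] tends to 0, [d t] enters the ball where the bound on [h] holds. *)
Lemma little_o_remainder k (d : R -> 'rV[R]_k) (h : 'rV[R]_k -> R) C N :
  (0 < N)%N -> little_o_t (fun t => `|d t| ^+ N) ->
  (\forall v \near (0 : 'rV[R]_k), `|h v| <= C * `|v| ^+ N) ->
  little_o_t (h \o d).
Proof.
move=> N0 od /nbhs_ballP[e /= e0 hC].
have hC' v : `|v| < e -> `|h v| <= C * `|v| ^+ N.
  by move=> ve; apply: hC; rewrite -ball_normE /= sub0r normrN.
apply: (@little_o_le _ (C *: (fun t => `|d t| ^+ N))).
- exact: little_oZ.
- have [/eqP + _] := od; rewrite expf_eq0 N0 /= normr_eq0 => /eqP /= ->.
  apply/eqP; rewrite -normr_le0 (le_trans (hC' _ _)) ?normr0 //.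
  by rewrite expr0n eqn0Ngt N0 mulr0.
have dl := cvgr_lt _ (little_o_cvg0 od) (e ^+ N).
have {}dl : \forall t \near 0^'+, `|d t| ^+ N < e ^+ N.
  by apply: dl; exact: exprn_gt0.
near=> t.
apply: le_trans (ler_norm _); apply: hC'.
rewrite -(ltr_pXn2r N0) ?nnegrE ?normr_ge0 ?(ltW e0) //.
by near: t.
Unshelve. all: by end_near. Qed.

Lemma continuous_row_mx_shift p n (q : 'rV[R]_p) (x : 'rV[R]_n) :
  row_mx q (x + r) @[r --> (0 : 'rV[R]_n)] --> row_mx q x.
Proof.
have FF : Filter (nbhs (0 : 'rV[R]_n)) := nbhs_filter (0 : 'rV[R]_n).
apply/(cvgrPdist_lt (FF := FF)) => e e0; apply/nbhs_ballP; exists e => //= r.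
rewrite -ball_normE /= sub0r normrN; apply: le_lt_trans.
rewrite opp_row_mx add_row_mx subrr opprD addrA subrr sub0r.
rewrite [leLHS]/Num.norm /= mx_normrE; apply/bigmax_leP; split => //.
move=> [i j] _ /=; rewrite (ord1 i); case: (split_ordP j) => l ->.
  by rewrite row_mxEl mxE normr0.
by rewrite row_mxEr mxE normrN ler_mx_entry.
Qed.

(** Translating by a real [r] moves only the standard point [z r], not the infinitesimal increment
    [d]. So [r] enters the Taylor expansion through the partial derivatives at [z r] alone, and
    these are continuous in [r]. *)
Lemma ext_fun_expansion p n (P : set 'rV[R]_p) (V : set 'rV[R]_n)
  (q : FRn R p) (alpha : 'rV[R]_(p + n) -> R) (x : FRn R n) :
  open V -> open P -> ext_set P q -> ext_set V x ->
  smooth_on [set z | P (lsubmx z) /\ V (rsubmx z)] alpha ->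
  exists (J : Type) (s : seq J) (m : J -> R -> R) (c : J -> 'rV[R]_n -> R),
    (forall j, c j r @[r --> (0 : 'rV[R]_n)] --> c j 0) /\
    \forall r \near (0 : 'rV[R]_n), ext_set V (fshift x r) /\
      fequiv (ext_fun alpha q (fshift x r)) (\sum_(j <- s) c j r *: m j).
Proof.
move=> oV oP [qR Pq] [xR Vx] sa.
set W := [set z | _] in sa.
have oW : open W.
  apply: openI; first by apply: open_comp => // z _; exact: continuous_lsubmx.
  by apply: open_comp => // z _; exact: continuous_rsubmx.
pose z r := row_mx (stdpartn q) (stdpartn x + r).
have cz : z r @[r --> (0 : 'rV[R]_n)] --> z 0.
  by rewrite {2}/z addr0; exact: continuous_row_mx_shift.
have Wz0 : W (z 0) by rewrite /W /= row_mxKl row_mxKr addr0.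
pose d t : 'rV[R]_(p + n) :=
  row_mx (\row_i (q i t - q i 0)) (\row_j (x j t - x j 0)).
have [i|N N0 oN] := @row_norm_little_o _ d.
  rewrite /d; case: (split_ordP i) => l ->.
    rewrite (_ : (fun t => _) = (fun t => q l t - q l 0)).
      exact: in_Rot_finite_order.
    by apply/funext => t; rewrite row_mxEl mxE.
  rewrite (_ : (fun t => _) = (fun t => x l t - x l 0)).
    exact: in_Rot_finite_order.
  by apply/funext => t; rewrite row_mxEr mxE.
(* An index is a pair of a degree below [N] and a word of that length; the factorial is put into the
   monomial [m], leaving a bare partial derivative as the coefficient. *)
exists (nat * seq 'I_(p + n))%type,
  [seq (nat_of_ord i, w) | i <- index_enum 'I_N, w <- words (p + n) i],
  (fun j t => (j.1`!%:R)^-1 * monomial (d t) j.2),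
  (fun j r => partialD alpha j.2 (z r)).
split=> [[i w] /=|].
  apply: (@cvg_comp _ _ _ z (partialD alpha w)
    (nbhs (0 : 'rV[R]_n)) (nbhs (z 0))) => //.
  by apply: differentiable_continuous; exact: sa.
have : \forall r \near (0 : 'rV[R]_n), W (z r).
  by apply: cz; exact: open_nbhs_nbhs.
apply: filterS => r Wz; split.
  split; last by rewrite stdpartn_fshift; case: Wz => _; rewrite row_mxKr.
  move=> i; have [a [s [s0 hs]]] := xR i.
  exists (a + r 0 i), s; split => //; move: hs; congr little_o_t.
  by apply/funext => t; rewrite /fshift [a + r 0 i + _]addrAC opprD [in RHS]opprD
    [- (_ + _) - r 0 i]addrC [RHS]addrA addrK opprD.
have [C hC] := taylor_smooth N oW sa Wz.
have := little_o_remainder N0 oN hC.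
rewrite /fequiv; congr little_o_t; apply/funext => t /=; congr (alpha _ - _).
  rewrite /z /d add_row_mx; congr row_mx; apply/rowP => i; rewrite !mxE.
    by rewrite addrC subrK.
  by rewrite /fshift addrAC [x i 0 + _]addrC subrK.
rewrite fct_sumE big_allpairs_dep; apply: eq_bigr => i _.
apply: eq_bigr => w _ /=; rewrite -[RHS]/(_ * _) /=.
by rewrite mulrC.
Qed.

(** * Decomposition of a Fermat real and its order *)

Lemma sum_partition_exponent (s : seq (R * R)) (B : seq R) (F : R -> R) :
  uniq B -> {subset [seq p.2^-1 | p <- s] <= B} ->
  \sum_(b <- B) (\sum_(p <- s | p.2^-1 == b) p.1) * F b =
  \sum_(p <- s) p.1 * F p.2^-1.
Proof.
move=> uB sB; under eq_bigr do rewrite mulr_suml.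
rewrite (exchange_big_dep predT) //= big_seq [RHS]big_seq.
apply: eq_bigr => p ps; have pB : p.2^-1 \in B by apply: sB; apply/mapP; exists p.
rewrite big_mkcond (bigD1_seq p.2^-1) //= eqxx big1 ?addr0 // => b.
by rewrite eq_sym => /negPf ->.
Qed.

(** Terms with exponent 0 are constants and go into [c]; those with exponent above 1 are o(t). *)
Lemma sum_powR_reduce (s : seq (R * R)) : all (fun p => 0 <= p.2) s ->
  exists c, fequiv (fun t => \sum_(p <- s) p.1 * t `^ p.2)
    (fun t => c + \sum_(p <- s | 0 < p.2 <= 1) p.1 * t `^ p.2).
Proof.
elim: s => [_|p s IH /= /andP[p0 /IH[c sc]]].
  exists 0; rewrite (_ : (fun t => \sum_(p <- _) _) =
      (fun t => 0 + \sum_(p <- [::] | 0 < p.2 <= 1) p.1 * t `^ p.2)).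
    exact: fequiv_refl.
  by apply/funext => t; rewrite !big_nil add0r.
move: p0; rewrite le_eqVlt => /predU1P[p0|p0].
  exists (p.1 + c); move: sc; rewrite /fequiv; congr little_o_t.
  apply/funext => t; rewrite !big_cons -p0 ltxx /= powRr0 mulr1 -!addrA.
  by rewrite [- (p.1 + _)]opprD [X in p.1 + X]addrCA addNKr.
have [p1|p1] := leP p.2 1.
  exists c; move: sc; rewrite /fequiv; congr little_o_t.
  apply/funext => t; rewrite !big_cons p0 p1 /= [c + (_ + _)]addrCA.
  by rewrite [- (p.1 * _ + _)]opprD addrACA subrr add0r.
exists c; have := little_oP p.1 (powR_little_o p1) sc.
rewrite /fequiv; congr little_o_t.
apply/funext => t; rewrite !big_cons p0 leNgt p1 /= -addrA.
by rewrite -[LHS]/(p.1 * t `^ p.2 + _).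
Qed.

Lemma in_Rot_decomp (x : FR R) : in_Rot x -> exists s, is_decomp x s.
Proof.
move=> [r [s [s0 xs]]].
have [c sc] := sum_powR_reduce s0.
pose F := [seq p <- s | 0 < p.2 <= 1].
(* [B] lists the distinct orders, that is the inverse exponents, in decreasing order; [coef] merges
   the terms of equal order, and [s'] drops those whose merged coefficient cancels. *)
pose B := rev (sort <=%O (undup [seq p.2^-1 | p <- F])).
pose coef b := \sum_(p <- F | p.2^-1 == b) p.1.
pose s' := [seq (coef b, b) | b <- [seq b <- B | coef b != 0]].
have B1 b : b \in B -> 1 <= b.
  rewrite mem_rev mem_sort mem_undup => /mapP[p + ->].
  by rewrite mem_filter => /andP[/andP[p0 p1] _]; rewrite invf_ge1.
have alls' : all (fun p => (1 <= p.2) && (p.1 != 0)) s'.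
  apply/allP => _ /mapP[b + ->] /=; rewrite mem_filter => /andP[-> /B1 ->].
  by [].
have xs' : fequiv x (fun t => (r + c) + \sum_(p <- s') p.1 * t `^ (p.2)^-1).
  have := little_oD xs sc.
  rewrite /fequiv; congr little_o_t; apply/funext => t.
  rewrite -[LHS]/(_ + _) -!addrA; congr (_ + _).
  rewrite [- (r + \sum_(p <- s) _)]opprD -addrA addKr -opprD.
  congr (- (_ + (_ + _))).
  rewrite /s' big_map big_filter /=.
  have -> : \sum_(b <- B | coef b != 0) coef b * t `^ b^-1 =
      \sum_(b <- B) coef b * t `^ b^-1.
    rewrite [RHS](bigID (fun b => coef b != 0)) /= [X in _ + X]big1 ?addr0 //.
    by move=> b /negPn/eqP ->; rewrite mul0r.
  rewrite (sum_partition_exponent (fun b => t `^ b^-1)).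
  - by rewrite /F big_filter; apply: eq_bigr => p _; rewrite invrK.
  - by rewrite rev_uniq sort_uniq undup_uniq.
  - by move=> b; rewrite mem_rev mem_sort mem_undup.
exists s'; split; [|split] => //.
  rewrite /s' sorted_map; apply: sorted_filter.
    by move=> b1 b2 b3 /= h1 h2; exact: lt_trans h2 h1.
  rewrite rev_sorted -[sorted _ _]/(sorted <%O _) sort_lt_sorted.
  exact: undup_uniq.
(* At t = 0 the o(t) difference and all the powers, whose exponents are nonzero, vanish, so the
   constant term is the standard part. *)
suff -> : stdpart x = r + c by [].
have [/eqP + _] := xs'; rewrite subr_eq0 => /eqP; rewrite /stdpart => ->.
rewrite big_seq big1 ?addr0 // => p /(allP alls')/andP[p1 _].
by rewrite powR0 ?mulr0 // invr_eq0 gt_eqF // (lt_le_trans _ p1).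
Qed.

Lemma in_Rot_sub (x y : FR R) : in_Rot x -> in_Rot y -> in_Rot (fsub x y).
Proof.
move=> [a [s [s0 xs]]] [b [u [u0 yu]]].
exists (a - b), (s ++ [seq (- p.1, p.2) | p <- u]); split.
  by rewrite all_cat s0 all_map.
have := little_oB xs yu; congr little_o_t; apply/funext => t.
rewrite -[LHS]/((x t - _) - (y t - _)) big_cat big_map /=.
under [X in _ - (_ + (_ + X))]eq_bigr do rewrite mulNr.
rewrite sumrN [a - b + _]addrACA -opprD /fsub !opprB.
by rewrite [LHS]addrACA [RHS]addrACA [- _ - y t]addrC.
Qed.

Lemma omega_ge0 (x : FR R) : 0 <= omega x.
Proof.
rewrite /omega; case: xgetP => // w _ [s [[_ [+ _]] ->]].
by case: s => //= p s /andP[/andP[p1 _] _]; rewrite (le_trans _ p1).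
Qed.

(** All orders in a decomposition are at least 1, so an order below 1 leaves only the empty
    decomposition. *)
Lemma omega_lt1 (x : FR R) : in_Rot x -> omega x < 1 ->
  fequiv x (fun=> stdpart x).
Proof.
move=> /in_Rot_decomp[s0 ds0]; rewrite /omega.
(* The existence of a decomposition excludes the default value of [xget]. *)
case: xgetP => [w _ [s [[_ [+ xs]] ->]]|/(_ (head (0, 0) s0).2) ns]; last first.
  by exfalso; apply: ns; exists s0.
case: s xs => [xs _ _|p s _ /= /andP[/andP[p1 _] _]]; last by rewrite ltNge p1.
by move: xs; rewrite /fequiv; under eq_fun do rewrite big_nil addr0.
Qed.

(** The vector [r] is the difference of the standard parts, whose sup norm is at most the Euclidean
    norm. Each order is at most the whole distance, hence below 1, so the difference is real in each
    coordinate. *)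
Lemma d_omega_fshift n (x y : FRn R n) e :
  in_Rotn x -> in_Rotn y -> e <= 1 -> d_omega x y < e ->
  exists2 r, `|r| < e & fequivn y (fshift x r).
Proof.
move=> xR yR e1 xye; pose r : 'rV[R]_n := \row_i (y i 0 - x i 0); exists r.
  have [d0|d0] := eqVneq (mx_norm r) 0.
    rewrite [`|r|]d0; apply: le_lt_trans xye.
    by rewrite addr_ge0 ?sqrtr_ge0 ?sumr_ge0 // => i _; exact: omega_ge0.
  have [[i j] /= dj] := mx_norm_neq0 d0.
  rewrite [`|r|]dj (ord1 i) mxE; apply: le_lt_trans xye.
  apply: (@le_trans _ _ (Num.sqrt (\sum_i (stdpart (x i) - stdpart (y i)) ^+ 2))).
    rewrite distrC -sqrtr_sqr; apply: ler_wsqrtr.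
    by rewrite (bigD1 j) //= lerDl sumr_ge0 // => k _; rewrite sqr_ge0.
  by rewrite lerDl sumr_ge0 // => k _; exact: omega_ge0.
move=> i; have xyi : omega (fsub (x i) (y i)) < 1.
  apply: lt_le_trans e1; apply: le_lt_trans xye.
  rewrite /d_omega [X in _ + X](bigD1 i) //= addrCA lerDl addr_ge0 ?sqrtr_ge0 //.
  by apply: sumr_ge0 => k _; exact: omega_ge0.
have := little_oN (omega_lt1 (in_Rot_sub (xR i) (yR i)) xyi).
congr little_o_t; apply/funext => t.
rewrite -[LHS]/(- (x i t - y i t - (x i 0 - y i 0))) /fshift mxE.
by rewrite !opprB [LHS]addrC opprD opprB !addrA.
Qed.

(** * Passage from the dense subset to all of [A] *)

Lemma identity_omega_dense n (A D : set (FRn R n)) (f g : FRn R n -> FR R) :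
  fsubset A -> fmap_on A f -> fmap_on A g ->
  qs_smooth A f -> qs_smooth A g ->
  D `<=` A -> omega_dense_in D A ->
  (forall x, D x -> fequiv (f x) (g x)) ->
  forall x, A x -> fequiv (f x) (g x).
Proof.
move=> [AR Asat] [_ fA] [_ gA] sf sg DA Dd fgD x Ax.
have [V [p [P [q [alpha [oV [Vx [oP [Pq [sa fE]]]]]]]]]] := sf x Ax.
have [V' [p' [P' [q' [beta [oV' [Vx' [oP' [Pq' [sb gE]]]]]]]]]] := sg x Ax.
have [J [s [m [c [cc cE]]]]] :=
  ext_fun_expansion oV oP Pq (conj (AR _ Ax) Vx) sa.
have [J' [s' [m' [c' [cc' cE']]]]] :=
  ext_fun_expansion oV' oP' Pq' (conj (AR _ Ax) Vx') sb.
pose S r := \sum_(j <- s) c j r *: m j.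
pose S' r := \sum_(j <- s') c' j r *: m' j.
have fS : \forall r \near (0 : 'rV[R]_n), A (fshift x r) ->
    fequiv (f (fshift x r)) (S r).
  apply: filterS cE => r [Vr ?] Ar; apply: fequiv_trans (fE _ Vr Ar) _.
  by [].
have gS : \forall r \near (0 : 'rV[R]_n), A (fshift x r) ->
    fequiv (g (fshift x r)) (S' r).
  apply: filterS cE' => r [Vr ?] Ar; apply: fequiv_trans (gE _ Vr Ar) _.
  by [].
(* The two expansions are joined over a sum type, so that their difference is a single combination
   of fixed functions. *)
have SE r : S r - S' r = \sum_(j <- map inl s ++ map inr s')
   (match j with inl i => c i | inr i => - c' i end) r *:
   (match j with inl i => m i | inr i => m' i end).
  rewrite big_cat !big_map /= -sumrN; congr (_ + _); apply: eq_bigr => i _.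
  by rewrite -scaleNr.
have x0 : fshift x 0 = x.
  by apply/funext => i; apply/funext => t; rewrite /fshift mxE addr0.
suff : little_o_t (S 0 - S' 0).
  move=> oS; have := nbhs_singleton fS; have := nbhs_singleton gS.
  rewrite x0 => /(_ Ax) gx /(_ Ax) fx.
  apply: fequiv_trans fx _; apply: fequiv_trans (fequiv_sym gx).
  exact: oS.
rewrite SE; apply: (@subspace_lim _ (@little_o_t R) _ (nbhs (0 : 'rV[R]_n)) _ _ _ _
  (fun j => match j with inl i => c i | inr i => - c' i end)
  (fun j => (match j with inl i => c i | inr i => - c' i end) 0)).
- exact: little_o0.
- exact: little_oP.
- by move=> [j|j]; [exact: cc|apply: cvgN; exact: cc'].
move=> B B0.
have : nbhs (0 : 'rV[R]_n) (B `&` ([set r | A (fshift x r) ->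
    fequiv (f (fshift x r)) (S r)] `&` [set r | A (fshift x r) ->
    fequiv (g (fshift x r)) (S' r)])).
  by apply: filterI => //; exact: filterI.
move=> /nbhs_ballP[e /= e0 eB].
(* The bound [e] puts the translation vector in the prescribed neighbourhood; the bound 1 makes the
   nearby point a real translate of [x]. *)
have e'0 : 0 < Num.min e 1 by rewrite lt_min e0 ltr01.
have [y [Dy xy]] := Dd x Ax _ e'0.
have Ay := DA _ Dy.
have [|r re yr] := d_omega_fshift (AR _ Ax) (AR _ Ay) _ xy.
  by rewrite ge_min lexx orbT.
have [|Br [fr gr]] := eB r.
  rewrite -ball_normE /= sub0r normrN (lt_le_trans re) //.
  by rewrite ge_min lexx.
have Ar := Asat _ _ Ay yr.
exists r => //; rewrite -SE.
(* The point [y] of [D] represents the same element as the translate; as [f] and [g] respect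
   equivalence, their agreement at [y] carries over. *)
apply: (@fequiv_trans _ (f (fshift x r))); first exact/fequiv_sym/fr.
apply: (@fequiv_trans _ (f y)); first exact/fequiv_sym/fA.
apply: (@fequiv_trans _ (g y)); first exact: fgD.
apply: (@fequiv_trans _ (g (fshift x r))); first exact/gA.
exact: gr.
Qed.

End FermatIdentity.

Theorem theorem5 (n : nat) (A : set (FRn Rdefinitions.R n))
  (f g : FRn Rdefinitions.R n -> FR Rdefinitions.R) :
  fsubset A -> fmap_on A f -> fmap_on A g ->
  qs_smooth A f -> qs_smooth A g ->
  forall D : set (FRn Rdefinitions.R n), D `<=` A -> omega_dense_in D A ->
  (forall x, D x -> fequiv (f x) (g x)) ->
  forall x, A x -> fequiv (f x) (g x).
Proof.
move=> AR fA gA sf sg D DA Dd fgD x Ax.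
exact: (identity_omega_dense AR fA gA sf sg DA Dd fgD Ax).
Qed.
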